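(* Every star-shaped Kakeya set $E\subset\mathbb{R}^2$ satisfies $$\mathcal{L}_2^*(E)\ \ge\ \frac{\pi}{98}.$$
   Context: A set $E\subset\mathbb{R}^2$ is star-shaped if there is a point $O\in E$ such that for every $x\in E$ the line segment $Ox$ is contained in $E$. A star-shaped Kakeya set is a star-shaped set $E\subset\mathbb{R}^2$ that contains a (closed) unit line segment in every direction, i.e. for every $\alpha\in[0,\pi)$ it contains a segment of length $1$ forming angle $\alpha$ with the $x$-axis. No continuity of the rotation of the segment is required, and $E$ is not assumed to be measurable. $\mathcal{L}_2^*$ denotes Lebesgue outer measure in $\mathbb{R}^2$. *)

(* Defs.v *)
From HB Require Import structures.
From mathcomp Require Import all_boot all_order all_algebra.
From mathcomp Require Import all_classical all_reals all_analysis.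

Set Implicit Arguments.
Unset Strict Implicit.
Unset Printing Implicit Defensive.

Import Order.TTheory GRing.Theory Num.Theory.

Local Open Scope classical_set_scope.
Local Open Scope ring_scope.

Section kakeya.
Context {R : realType}.
Implicit Types (p q : R * R) (E : set (R * R)).

Definition segment p q : set (R * R) :=
  [set ((1 - t) * p.1 + t * q.1, (1 - t) * p.2 + t * q.2) | t in `[0, 1]].

Definition star_shaped E :=
  exists2 O, E O & forall x, E x -> segment O x `<=` E.

(* The endpoints are [p] and [p + (cos alpha, sin alpha)], so the length is 1. *)
Definition has_unit_segment_at E (alpha : R) :=
  exists p, segment p (p.1 + cos alpha, p.2 + sin alpha) `<=` E.

Definition star_shaped_kakeya E :=
  star_shaped E /\
  forall alpha, 0 <= alpha < pi -> has_unit_segment_at E alpha.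

(* The Caratheodory outer measure of the plane Lebesgue measure, defined on
   arbitrary sets: the infimum of the total area of countable covers by Borel
   sets. Covers by rectangles give the same value, the product measure being
   itself approximated from above by countable unions of rectangles. *)
Definition lebesgue_outer_measure2 : set (R * R) -> \bar R :=
  mu_ext (lebesgue_measure \x lebesgue_measure)%E.

End kakeya.

(* Main.v *)
(** Put the star centre at the origin and let [G] be a measurable set of area
    [a < +oo] containing [E]. For a direction [al], the unit segment lies on a line
    at distance [h] from the origin, and [h <= 2 a] because the triangle it spans
    with the origin lies in [G]. Its end farther from the foot of the perpendicular
    is at distance [d >= 1/2] from the foot. Let [th = atan (h / d)].
    - If [h > 0], the last quarter of the segment spans with the origin a triangle
      of area [h / 8 >= th / 16] inside the sector of directions between [al] and
      [al + 2 th] (or [al - 2 th]): the area in that sector is at least 1/32 of its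
      angle. Covering greedily from left to right, the directions of one
      orientation reached in one half-plane have outer measure at most 32 times
      the area of [G] in that half-plane.
    - If [h = 0], [G] contains a radial segment of length 1/2; vertical slices bound
      the outer measure of these directions by 17 times the area.
    To avoid wrapping around, directions within [2 th <= 8 a] of the vertical are
    discarded. Altogether [pi <= 32 a + 32 a + 17 a + 2 * 8 a = 97 a]. *)

Require Import Defs.
From HB Require Import structures.
From mathcomp Require Import all_boot all_order all_algebra.
From mathcomp Require Import all_classical all_reals all_analysis.
From mathcomp Require Import measurable_realfun ring lra.

Import Order.TTheory GRing.Theory Num.Theory.
Import numFieldNormedType.Exports.

Local Open Scope classical_set_scope.
Local Open Scope ring_scope.

Set Implicit Arguments.
Unset Strict Implicit.
Unset Printing Implicit Defensive.

Local Notation lambda := (@lebesgue_measure _).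
Local Notation area := (lebesgue_measure \x lebesgue_measure)%E.

(** * Outer measures of arbitrary sets *)

Lemma mu_ext_approx d (T : measurableType d) (R : realType)
    (mu : {measure set T -> \bar R}) (A : set T) (K e : R) :
  (mu_ext mu A <= K%:E)%E -> 0 < e ->
  exists B, [/\ measurable B, A `<=` B & (mu B <= (K + e)%:E)%E].
Proof.
move=> AK e0.
have /ereal_inf_lt[_ [F [mF AF] <-] FKe] : (mu_ext mu A < (K + e)%:E)%E.
  by rewrite (le_lt_trans AK)// lte_fin ltrDl.
exists (\bigcup_n F n); split => //; first exact: bigcupT_measurable.
apply: le_trans (ltW FKe).
by apply: measure_sigma_subadditive => //; exact: bigcupT_measurable.
Qed.

Lemma mu_ext_le_measurable d (T : measurableType d) (R : realType)
    (mu : {measure set T -> \bar R}) (A B : set T) :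
  measurable B -> A `<=` B -> (mu_ext mu A <= mu B)%E.
Proof.
by move=> mB AB; rewrite -(measurable_mu_extE mu mB); exact: le_mu_ext.
Qed.

(** Direction sets need not be measurable, so continuity from below goes through measurable hulls.
    If [B k] is a hull of [A k] up to [e], the intersection [C n] of the [B k] with [k >= n] still
    contains [A n], has measure at most [K + e], and increases with [n]. *)
Lemma mu_ext_bigcup_nondecreasing d (T : measurableType d) (R : realType)
    (mu : {measure set T -> \bar R}) (A : (set T)^nat) (K : R) :
  (forall n, A n `<=` A n.+1) -> (forall n, (mu_ext mu (A n) <= K%:E)%E) ->
  (mu_ext mu (\bigcup_n A n) <= K%:E)%E.
Proof.
move=> ndA AK; apply/lee_addgt0Pr => e e0.
have /choice[B HB] n := mu_ext_approx (AK n) e0.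
have mB n : measurable (B n) by have [] := HB n.
have AB n : A n `<=` B n by have [] := HB n.
have BK n : (mu (B n) <= (K + e)%:E)%E by have [] := HB n.
have subA n m : (n <= m)%N -> A n `<=` A m.
  elim: m => [|m IH]; first by rewrite leqn0 => /eqP ->.
  rewrite leq_eqVlt => /orP[/eqP -> //|/IH]; move/subset_trans; exact.
pose C n := \bigcap_(k >= n) B k.
have mC n : measurable (C n) by apply: bigcap_measurable => //; exists n => /=.
have mUC : measurable (\bigcup_n C n) by exact: bigcupT_measurable.
have AC : \bigcup_n A n `<=` \bigcup_n C n.
  by move=> x [n _ Anx]; exists n => // k /= nk; apply: AB; exact: subA nk _ Anx.
apply: (le_trans (mu_ext_le_measurable mu mUC AC)).
have ndC : nondecreasing_seq C.
  by move=> n m nm; apply/subsetPset => x Cx k /= mk; apply: Cx => /=; exact: leq_trans mk.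
have cvgC := nondecreasing_cvg_mu (mu := mu) mC mUC ndC.
rewrite -EFinD -(cvg_lim _ cvgC)//; apply: lime_le.
  by apply/cvg_ex; eexists; exact: cvgC.
apply: nearW => n /=; apply: le_trans (BK n).
by apply: le_measure; rewrite ?inE//; move=> x; apply => /=.
Qed.

(** * A one-dimensional covering argument *)

Section greedy_cover.
Context {R : realType}.
Variables (v : R -> R) (lo hi c : R) (M : set R).
Hypotheses (c0 : 0 < c)
  (vni : forall s t, lo <= s -> s <= t -> t <= hi -> v t <= v s)
  (vhi : 0 <= v hi).
Let lambda : set R -> \bar R := mu_ext (@lebesgue_measure R).

Let step (d : R) : set R := [set al | [/\ M al, lo <= al & exists l,
  [/\ d <= l, al + l <= hi & c * l <= v al - v (al + l)]]].

(** Induction on the number of steps of length [d] needed to get from [t] to [hi]. One step covers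
    everything left of [al + l] by an interval of length at most [l + e]; the decrease of [v]
    between [al] and [al + l] pays for [l], and the errors add up to [e *+ n]. *)
Let greedy_step (d e : R) : 0 < d -> 0 < e -> forall n t,
  lo <= t -> t <= hi -> hi - t <= d *+ n ->
  (lambda (step d `&` `[t, +oo[) <= (v t / c + e *+ n)%:E)%E.
Proof.
move=> d0 e0; elim=> [|n IH] t lot thi tn; have vt0 : 0 <= v t.
- exact: le_trans vhi (vni lot thi (lexx _)).
- have -> : step d `&` `[t, +oo[ = set0; last first.
    by rewrite /lambda outer_measure0 lee_fin mulr0n addr0 divr_ge0// ltW.
  rewrite -subset0 => al [[_ _ [l [dl alhi _]]]] /=; rewrite in_itv/= andbT => tal.
  move: tn; rewrite mulr0n => tn; lra.
- exact: le_trans vhi (vni lot thi (lexx _)).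
have [->|/set0P[a0 Aa0]] := eqVneq (step d `&` `[t, +oo[) set0.
  by rewrite /lambda outer_measure0 lee_fin addr_ge0// ?mulrn_wge0 ?divr_ge0// ltW.
set A := step d `&` `[t, +oo[ in Aa0 *.
have At x : A x -> t <= x by move=> [_ /=]; rewrite in_itv/= andbT.
have hA : has_inf A by split; [exists a0|exists t => x /At].
(* The infimum of the remaining directions may not be attained: [al] is a direction within [e] of
   it, while the covering interval starts at the infimum itself so that nothing is missed. *)
have [al Aal als] := inf_adherent e0 hA.
have [[_ loal [l [dl alhi cl]]] tal] := Aal.
have tal' := At _ Aal.
have infA : t <= inf A by apply: lb_le_inf; [exists a0|move=> x /At].
have sub : A `<=` `[inf A, al + l[ `|` (step d `&` `[al + l, +oo[).
  move=> x Ax; have [xal|alx] := ltP x (al + l); [left|right].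
    by rewrite /= in_itv/= xal andbT; apply: ge_inf => //; case: hA.
  by case: Ax => Sx _; split => //=; rewrite in_itv/= alx.
move: sub infA als; move: (inf A) => i sub infA als.
apply: (le_trans (le_mu_ext _ sub)).
apply: (le_trans (outer_measureU2 (mu_ext (@lebesgue_measure R)) _ _)).
have inn : hi - (al + l) <= d *+ n by move: tn; rewrite mulrS => tn; lra.
have len : (lambda `[i, (al + l)%R[ <= (l + e)%:E)%E.
  rewrite /lambda measurable_mu_extE//; rewrite /= lebesgue_measure_itv/= lte_fin.
  by case: ifPn => _; rewrite ?EFinN -?EFinD lee_fin; lra.
have := IH (al + l) ltac:(lra) ltac:(lra) inn.
move=> /(leeD len)/le_trans; apply; rewrite -EFinD lee_fin mulrS.
have vat : v al <= v t by apply: vni => //; lra.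
have : l <= v t / c - v (al + l) / c.
  rewrite -mulrBl ler_pdivlMr//; lra.
by move=> ?; lra.
Qed.

(* The intervals [[al, al + l]] are chosen greedily from left to right; those
   longer than a fixed [d] are exhausted after finitely many steps, which is
   why no Vitali constant is lost. *)
Lemma greedy_cover :
  lo <= hi -> M `<=` `[lo, hi] ->
  (forall al, M al -> exists l,
     [/\ 0 < l, al + l <= hi & c * l <= v al - v (al + l)]) ->
  (mu_ext (@lebesgue_measure R) M <= (v lo / c)%:E)%E.
Proof.
move=> lohi Mlohi HM.
pose S n := step (n.+1%:R^-1).
have -> : M = \bigcup_n S n.
  apply/seteqP; split => [al Mal|al [n _] []//].
  have [l [l0 alhi cl]] := HM _ Mal.
  have [n nl] := ltr_add_invr l0; rewrite add0r in nl.
  exists n => //; split => //; first by have /= := Mlohi _ Mal; rewrite in_itv/= => /andP[].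
  by exists l; split => //; exact: ltW.
apply: mu_ext_bigcup_nondecreasing => n.
  move=> al [Mal loal [l [nl alhi cl]]]; split => //; exists l; split => //.
  by apply: le_trans nl; rewrite lef_pV2 ?posrE ?ltr0n// ler_nat.
apply/lee_addgt0Pr => e e0.
set d : R := n.+1%:R^-1; have d0 : 0 < d by rewrite invr_gt0 ltr0n.
pose k := Num.bound ((hi - lo) / d).
have kd : hi - lo <= d *+ k.
  rewrite -mulr_natr mulrC -ler_pdivrMr//; apply/ltW/archi_boundP.
  by rewrite divr_ge0 ?subr_ge0 ?(ltW d0).
(* There are at most [k] steps, so this error per step costs at most [e] in total; [k.+1] keeps the
   divisor positive. *)
have ek : 0 < e / k.+1%:R by rewrite divr_gt0 ?ltr0n.
have -> : S n = S n `&` `[lo, +oo[.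
  by apply/esym/setIidPl => x [_ lox _] /=; rewrite in_itv/= lox.
apply: (le_trans (greedy_step d0 ek (lexx _) lohi kd)).
rewrite -EFinD lee_fin lerD2l -mulrnAr ler_piMr ?(ltW e0)//.
by rewrite -[_ *+ k]mulr_natl ler_pdivrMr ?ltr0n// mul1r ler_nat.
Qed.

End greedy_cover.

(** * Areas from vertical slices *)

(* The product measure lives on [measurableTypeR R * measurableTypeR R], whose
   display differs from the one inferred for [R * R]; the next three lemmas
   restate facts about measures for the latter. *)
Lemma le_area (R : realType) (A B : set (R * R)) :
  measurable A -> measurable B -> A `<=` B -> (area A <= area B)%E.
Proof. by move=> mA mB AB; apply: le_measure => //; apply/mem_set. Qed.

Lemma area_setU (R : realType) (A B : set (R * R)) :
  measurable A -> measurable B -> A `&` B = set0 ->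
  area (A `|` B) = (area A + area B)%E.
Proof. by move=> mA mB AB; apply: measureU. Qed.

Lemma area_setD (R : realType) (A B : set (R * R)) :
  measurable A -> measurable B -> B `<=` A -> (area A < +oo)%E ->
  area (A `\` B) = (area A - area B)%E.
Proof.
move=> mA mB BA Aoo; transitivity (area A - area (A `&` B))%E; first exact: measureD.
by congr (_ - area _)%E; exact/setIidPr.
Qed.

Lemma integral_affine (R : realType) (a b p q : R) : a <= b ->
  (\int[lambda]_(x in `]a, b[) (p * x + q)%:E =
   (p * (b ^+ 2 - a ^+ 2) / 2 + q * (b - a))%:E)%E.
Proof.
rewrite le_eqVlt => /predU1P[->|ab].
  by rewrite set_itvoo0 integral_set0 !subrr mulr0 mul0r add0r mulr0.
pose F (x : R) := p * (x ^+ 2) / 2 + q * x.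
have dF (x : R) : is_derive x 1 F (p * x + q).
  rewrite /F; apply: is_derive_eq.
  by rewrite /GRing.scale /= !mulr1; field.
have cF : continuous F.
  by move=> x; apply: differentiable_continuous; apply/derivable1_diffP; case: (dF x).
have cf : continuous (fun x : R => p * x + q).
  by move=> x; apply: cvgD; [apply: cvgM; [exact: cvg_cst|exact: cvg_id]|exact: cvg_cst].
rewrite -(@integral_itv_bndoo _ a b _ true false); last first.
  apply/measurable_EFinP/measurable_funTS; exact: continuous_measurable_fun.
rewrite (@continuous_FTC2 _ _ F)//.
- by rewrite -EFinB /F; congr EFin; ring.
- exact: continuous_subspaceT.
- split.
  + by move=> x _; case: (dF x).
  + by apply: cvg_at_right_filter; exact: cF.
  + by apply: cvg_at_left_filter; exact: cF.
- by move=> x _; rewrite derive1E; have [_ ->] := dF x.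
Qed.

Lemma integral_xsection_ge (R : realType) (S : set (R * R)) (a b p q : R) :
  measurable S -> a <= b ->
  (forall x, a < x < b -> 0 <= p * x + q) ->
  (forall x, a < x < b -> ((p * x + q)%:E <= lambda (xsection S x))%E) ->
  ((p * (b ^+ 2 - a ^+ 2) / 2 + q * (b - a))%:E <=
   \int[lambda]_(x in `]a, b[) lambda (xsection S x))%E.
Proof.
move=> mS ab pq0 pqS; rewrite -integral_affine//; apply: ge0_le_integral => //.
- apply/measurable_EFinP/measurable_funTS; apply: continuous_measurable_fun.
  by move=> x; apply: cvgD; [apply: cvgM; [exact: cvg_cst|exact: cvg_id]|exact: cvg_cst].
- by apply/measurable_funTS; exact: measurable_fun_xsection.
Qed.

(** Fubini on two adjacent strips: a triangle is cut at its middle vertex, where the slice length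
    changes slope. Taking [b = c] leaves a single strip. *)
Lemma integral_itv2_le_area (R : realType) (S : set (R * R)) (a b c : R) :
  measurable S ->
  (\int[lambda]_(x in `]a, b[) lambda (xsection S x) +
   \int[lambda]_(x in `]b, c[) lambda (xsection S x) <= area S)%E.
Proof.
move=> mS; have mf := measurable_fun_xsection (@lebesgue_measure R) mS.
rewrite -ge0_integral_setU//.
- apply: ge0_subset_integral => //; exact: measurableU.
- exact: measurable_funTS.
- apply/eqP; rewrite -subset0 => x [] /=.
  by rewrite !in_itv/= => /andP[_ xb] /andP[/(lt_trans xb)]; rewrite ltxx.
Qed.

(** Strictly positive barycentric coordinates: the boundary is left out because the sectors met
    later do not contain the origin, which is a vertex of the triangles used. *)
Definition contains_open_triangle (R : realType) (S : set (R * R))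
    (A B C : R * R) :=
  forall s t u, 0 < s -> 0 < t -> 0 < u -> s + t + u = 1 ->
    S (s * A.1 + t * B.1 + u * C.1, s * A.2 + t * B.2 + u * C.2).

(** Twice the signed area of the triangle. *)
Definition det3 (R : realType) (A B C : R * R) : R :=
  (B.1 - A.1) * (C.2 - A.2) - (C.1 - A.1) * (B.2 - A.2).

(** The slope [k] may have either sign, since the middle vertex of a triangle may lie above or below
    the opposite side. *)
Lemma lebesgue_xsection_ge (R : realType) (S : set (R * R)) (x y0 k r : R) :
  measurable S -> 0 <= r ->
  (forall t, 0 < t -> t < r -> S (x, y0 + t * k)) ->
  ((`|k| * r)%:E <= lambda (xsection S x))%E.
Proof.
move=> mS r0 HS.
have mSx : measurable (xsection S x) by exact: measurable_xsection.
have [->|k0] := eqVneq k 0; first by rewrite normr0 mul0r measure_ge0.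
pose I := `](y0 + Num.min 0 (r * k)), (y0 + Num.max 0 (r * k))[%classic : set R.
have IS : I `<=` xsection S x.
  move=> y; rewrite /I /= in_itv/= => yI; rewrite /xsection /= inE.
  have -> : y = y0 + (y - y0) / k * k by rewrite divfK// addrC subrK.
  have [kpos|kneg] : 0 < k \/ k < 0 by move: k0; rewrite neq_lt => /orP[]; [right|left].
    have rk : 0 <= r * k by rewrite mulr_ge0// ltW.
    move: yI; rewrite (min_idPl rk) (max_idPr rk) => /andP[y1 y2].
    by apply: HS; rewrite ?divr_gt0 ?ltr_pdivrMr//; lra.
  have rk : r * k <= 0 by rewrite mulr_ge0_le0// ltW.
  move: yI; rewrite (min_idPr rk) (max_idPl rk) => /andP[y1 y2].
  apply: HS; last by rewrite ltr_ndivrMr//; lra.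
  by rewrite -mulrNN -invrN divr_gt0//; lra.
apply: (@le_trans _ _ (lambda I)); last first.
  by apply: le_measure; rewrite ?inE//; exact: measurable_itv.
rewrite /I lebesgue_measure_itv/= lte_fin.
have -> : `|k| * r = (y0 + Num.max 0 (r * k)) - (y0 + Num.min 0 (r * k)).
  rewrite -{1}(ger0_norm r0) -normrM [k * r]mulrC.
  by case: leP => rk; [rewrite ger0_norm|rewrite ltr0_norm]; rewrite //; ring.
case: ifPn => [_|]; first by rewrite -EFinD.
by rewrite -leNgt => ?; rewrite lee_fin; lra.
Qed.

(** The slice at abscissa [x] starts on the side [AC], at height [y0 x]. Its length grows linearly
    from 0 at [A] to [|k|] at [B] and falls back linearly to 0 at [C], where [k] is the vertical
    distance from [AC] to [B], with sign. Integrating the two affine pieces gives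
    [|k| * (c - a) / 2]. *)
Lemma triangle_area_sorted (R : realType) (S : set (R * R)) (A B C : R * R) :
  measurable S -> A.1 <= B.1 -> B.1 <= C.1 -> contains_open_triangle S A B C ->
  ((`|det3 A B C| / 2)%:E <= area S)%E.
Proof.
case: A B C => [a a'] [b b'] [c c'] mS /= ab bc ST.
rewrite /det3 /=.
have [ac|ac] : a = c \/ a < c by move: (le_trans ab bc); rewrite le_eqVlt => /predU1P.
  have -> : b = a by apply/eqP; rewrite eq_le ab andbT ac.
  by rewrite ac !subrr !mul0r subrr normr0 mul0r measure_ge0.
have ca : 0 < c - a by lra.
pose k := (b' - a') - (b - a) * (c' - a') / (c - a).
pose y0 (x : R) := a' + (x - a) * (c' - a') / (c - a).
(* This point of the slice has barycentric weight [t] at [B]; the two upper bounds on [t] say that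
   the weights at [A] and [C] are positive. *)
have inS (x t : R) : 0 < t -> t * (c - b) < c - x -> t * (b - a) < x - a ->
    S (x, y0 x + t * k).
  move=> t0 tc ta.
  have s0 : 0 < ((c - x) - t * (c - b)) / (c - a) by rewrite divr_gt0//; lra.
  have u0 : 0 < ((x - a) - t * (b - a)) / (c - a) by rewrite divr_gt0//; lra.
  have stu : ((c - x) - t * (c - b)) / (c - a) + t +
      ((x - a) - t * (b - a)) / (c - a) = 1 :> R by field; lra.
  have := ST _ _ _ s0 t0 u0 stu; congr (S (_, _)); rewrite /= /y0 /k; field; lra.
have -> : `|(b - a) * (c' - a') - (c - a) * (b' - a')| = `|k| * (c - a).
  rewrite -{2}(gtr0_norm ca) -normrM -normrN; congr (`|_|).
  by rewrite /k; field; lra.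
apply: le_trans (integral_itv2_le_area a b c mS).
have -> : `|k| * (c - a) / 2 = `|k| * (b - a) / 2 + `|k| * (c - b) / 2 by field.
rewrite EFinD; apply: leeD.
- move: ab; rewrite le_eqVlt => /predU1P[->|ab].
    by rewrite subrr mulr0 mul0r integral_ge0.
  have ba : 0 < b - a by lra.
  pose p := `|k| / (b - a).
  have -> : `|k| * (b - a) / 2 = p * (b ^+ 2 - a ^+ 2) / 2 + (- p * a) * (b - a).
    by rewrite /p; field; lra.
  have pE (x : R) : p * x + - p * a = `|k| * ((x - a) / (b - a)).
    by rewrite /p; field; lra.
  apply: integral_xsection_ge => //; first exact: ltW.
    by move=> x /andP[ax xb]; rewrite pE mulr_ge0// divr_ge0//; lra.
  move=> x /andP[ax xb]; rewrite pE; apply: (@lebesgue_xsection_ge _ _ _ (y0 x)) => //.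
    by rewrite divr_ge0//; lra.
  move=> t t0; rewrite ltr_pdivlMr// => txa; apply: inS => //.
  have : t < 1 by rewrite -(ltr_pM2r ba) mul1r; lra.
  move=> t1; apply: (@le_lt_trans _ _ (1 * (c - b))); last lra.
  by apply: ler_wpM2r; lra.
- move: bc; rewrite le_eqVlt => /predU1P[->|bc].
    by rewrite subrr mulr0 mul0r integral_ge0.
  have cb : 0 < c - b by lra.
  pose p := `|k| / (c - b).
  have -> : `|k| * (c - b) / 2 = - p * (c ^+ 2 - b ^+ 2) / 2 + (p * c) * (c - b).
    by rewrite /p; field; lra.
  have pE (x : R) : - p * x + p * c = `|k| * ((c - x) / (c - b)).
    by rewrite /p; field; lra.
  apply: integral_xsection_ge => //; first exact: ltW.
    by move=> x /andP[ax xb]; rewrite pE mulr_ge0// divr_ge0//; lra.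
  move=> x /andP[ax xb]; rewrite pE; apply: (@lebesgue_xsection_ge _ _ _ (y0 x)) => //.
    by rewrite divr_ge0//; lra.
  move=> t t0; rewrite ltr_pdivlMr// => txa; apply: inS => //.
  have : t < 1 by rewrite -(ltr_pM2r cb) mul1r; lra.
  move=> t1; apply: (@le_lt_trans _ _ (1 * (b - a))); last lra.
  by apply: ler_wpM2r; lra.
Qed.

(** Hypothesis and bound are invariant under transposing vertices, so the vertices can be sorted by
    abscissa. *)
Lemma triangle_area (R : realType) (S : set (R * R)) (A B C : R * R) :
  measurable S -> contains_open_triangle S A B C ->
  ((`|det3 A B C| / 2)%:E <= area S)%E.
Proof.
move=> mS.
have swap12 (A' B' C' : R * R) : contains_open_triangle S A' B' C' ->
    contains_open_triangle S B' A' C' /\ `|det3 B' A' C'| = `|det3 A' B' C'|.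
  move=> ST; split; last by rewrite -normrN /det3; congr (`|_|); ring.
  move=> s t u s0 t0 u0 stu; have := ST t s u t0 s0 u0.
  by rewrite (addrC t s) stu => /(_ erefl); congr (S (_, _)); rewrite /=; ring.
have swap23 (A' B' C' : R * R) : contains_open_triangle S A' B' C' ->
    contains_open_triangle S A' C' B' /\ `|det3 A' C' B'| = `|det3 A' B' C'|.
  move=> ST; split; last by rewrite -normrN /det3; congr (`|_|); ring.
  move=> s t u s0 t0 u0 stu; have := ST s u t s0 u0 t0.
  by rewrite addrAC stu => /(_ erefl); congr (S (_, _)); rewrite /=; ring.
wlog AB : A B / A.1 <= B.1 => [H ST|ST].
  have [AB|/ltW BA] := leP A.1 B.1; first exact: H.
  by have [ST1 <-] := swap12 _ _ _ ST; exact: H.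
wlog AC : A B C AB ST / A.1 <= C.1 => [H|].
  have [AC|/ltW CA] := leP A.1 C.1; first exact: H.
  have [ST1 <-] := swap23 _ _ _ ST; have [ST2 <-] := swap12 _ _ _ ST1.
  by apply: H => //; exact: le_trans CA AB.
have [BC|/ltW CB] := leP B.1 C.1; first exact: triangle_area_sorted.
by have [ST1 <-] := swap23 _ _ _ ST; exact: triangle_area_sorted.
Qed.

(** * Symmetries of the line and the plane *)

Definition measure_preserving d (T : measurableType d) (R : realType)
    (mu : set T -> \bar R) (f : T -> T) :=
  measurable_fun setT f /\ forall A, measurable A -> mu (f @^-1` A) = mu A.

Lemma measurable_preimage d (T : measurableType d) (R : realType)
    (mu : set T -> \bar R) (f : T -> T) (A : set T) :
  measure_preserving mu f -> measurable A -> measurable (f @^-1` A).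
Proof. by move=> [mf _] mA; rewrite -[X in measurable X]setTI; exact: mf. Qed.

Lemma lebesgue_preserving_id (R : realType) :
  measure_preserving (@lebesgue_measure R) id.
Proof. by split. Qed.

(** By uniqueness of Lebesgue measure it suffices to compare lengths of half-open intervals.
    Translations are composites of two such reflections, and negation is the case [u = 0]. *)
Lemma lebesgue_preserving_subr (R : realType) (u : R) :
  measure_preserving (@lebesgue_measure R) (fun x => u - x).
Proof.
have mf : measurable_fun setT (fun x : measurableTypeR R => u - x : measurableTypeR R).
  by apply: measurable_funB.
split => // A mA.
rewrite -[LHS]/(pushforward lambda (fun x : measurableTypeR R => u - x : measurableTypeR R) A).
apply/esym; apply: lebesgue_measure_unique => // _ [[a b] _ <-].
rewrite /pushforward [X in _ = lambda X](_ : _ = `[u - b, u - a[%classic); last first.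
  by apply/seteqP; split => x /=; rewrite !in_itv/= => /andP[? ?]; apply/andP; split; lra.
rewrite !lebesgue_measure_itv/= !lte_fin (_ : (u - b < u - a) = (a < b)); last first.
  by apply/idP/idP => ?; lra.
by case: ifP => // _; rewrite -!EFinD; congr EFin; ring.
Qed.

Lemma lebesgue_preserving_addr (R : realType) (u : R) :
  measure_preserving (@lebesgue_measure R) (fun x => x + u).
Proof.
have [m1 p1] := @lebesgue_preserving_subr R u.
have [m2 p2] := @lebesgue_preserving_subr R 0.
have eq : (fun x => x + u) = (fun x : R => u - x) \o (fun x => 0 - x).
  by apply/funext => x /=; ring.
split => [|A mA]; rewrite eq; first exact: measurableT_comp.
rewrite comp_preimage p2 ?p1//.
exact: measurable_preimage (@lebesgue_preserving_subr R u) mA.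
Qed.

(** The pushforward of the area agrees with the area on rectangles, which determines the product
    measure. *)
Lemma area_preserving_pair (R : realType) (f g : R -> R) :
  measure_preserving (@lebesgue_measure R) f ->
  measure_preserving (@lebesgue_measure R) g ->
  measure_preserving (lebesgue_measure \x @lebesgue_measure R)%E
    (fun p => (f p.1, g p.2)).
Proof.
move=> [mf pf] [mg pg].
have mfg : measurable_fun setT (fun p : measurableTypeR R * measurableTypeR R =>
    (f p.1, g p.2) : measurableTypeR R * measurableTypeR R).
  by apply: measurable_fun_pair; apply: measurableT_comp.
split => // A mA; rewrite -[LHS]/(pushforward area (fun p : measurableTypeR R * measurableTypeR R =>
    (f p.1, g p.2) : measurableTypeR R * measurableTypeR R) A).
apply/esym; apply: product_measure_unique => // B C mB mC.
transitivity (area ((f @^-1` B) `*` (g @^-1` C))) => //.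
rewrite [LHS]product_measure1E.
- by congr (_ * _)%E; [exact: pf|exact: pg].
- exact: measurable_preimage (conj mf pf) mB.
- exact: measurable_preimage (conj mg pg) mC.
Qed.

Lemma area_preserving_swap (R : realType) :
  measure_preserving (lebesgue_measure \x @lebesgue_measure R)%E
    (fun p => (p.2, p.1)).
Proof.
have ms : measurable_fun setT (fun p : measurableTypeR R * measurableTypeR R =>
    (p.2, p.1) : measurableTypeR R * measurableTypeR R).
  by apply: measurable_fun_pair.
split => // A mA; rewrite -[LHS]/(pushforward area (fun p : measurableTypeR R * measurableTypeR R =>
    (p.2, p.1) : measurableTypeR R * measurableTypeR R) A).
apply/esym; apply: product_measure_unique => // B C mB mC.
transitivity (area (C `*` B)).
  rewrite /pushforward; congr product_measure1.
  by apply/seteqP; split => -[x y] [].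
by rewrite [LHS]product_measure1E// muleC.
Qed.

(** Transfers bounds on sets of directions when the plane is reflected or rotated, by pulling back a
    nearly optimal measurable hull of [N]. *)
Lemma mu_ext_preimage_le (R : realType) (f : R -> R) (M N : set R) (K : R) :
  measure_preserving (@lebesgue_measure R) f -> M `<=` f @^-1` N ->
  (mu_ext (@lebesgue_measure R) N <= K%:E)%E ->
  (mu_ext (@lebesgue_measure R) M <= K%:E)%E.
Proof.
move=> pf MN NK; apply/lee_addgt0Pr => e e0.
have [B [mB NB BK]] := mu_ext_approx NK e0.
rewrite -EFinD; apply: le_trans BK.
apply: (@le_trans _ _ (lambda (f @^-1` B))); last by rewrite (pf.2 _ mB).
apply: mu_ext_le_measurable; first exact: measurable_preimage pf mB.
by move=> x /MN/NB.
Qed.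

(** * Sectors and thin triangles *)

Lemma atan_lipschitz (R : realType) (a b : R) : a <= b -> atan b - atan a <= b - a.
Proof.
move=> ab; have datan (x : R) : is_derive x 1 (@atan R) (1 + x ^+ 2)^-1.
  by rewrite -derive1_atan derive1E; apply/derivableP; exact: derivable_atan.
have [] := @MVT_segment R (@atan R) (fun x => (1 + x ^+ 2)^-1) a b ab (fun x _ => datan x).
  by apply: continuous_subspaceT => x; exact: continuous_atan.
move=> x _ ->; rewrite ler_piMl ?subr_ge0// invf_le1 ?lerDl ?sqr_ge0//.
by rewrite ltr_pwDl// sqr_ge0.
Qed.

Lemma atan_le_id (R : realType) (t : R) : 0 <= t -> atan t <= t.
Proof. by move=> /atan_lipschitz; rewrite atan0 !subr0. Qed.

(** For [s] between [-pi/2] and [pi/2], the points of the open right half-plane with polar angle at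
    least [s], expressed by a cross product with [(cos s, sin s)]. At [s = pi/2] this is empty. *)
Definition right_sector (R : realType) (s : R) : set (R * R) :=
  [set p | 0 < p.1 /\ p.1 * sin s <= p.2 * cos s].

Lemma measurable_right_sector (R : realType) (s : R) :
  measurable (right_sector s).
Proof.
rewrite (_ : right_sector s = (fst @^-1` `]0, +oo[) `&`
    ((fun p : measurableTypeR R * measurableTypeR R =>
      p.2 * cos s - p.1 * sin s : measurableTypeR R) @^-1` `[0, +oo[)); last first.
  by apply/seteqP; split => -[x y] /=; rewrite /right_sector /= !in_itv/= !andbT subr_ge0.
apply: measurableI.
  by rewrite -[X in measurable X]setTI; exact: measurable_fst.
rewrite -[X in measurable X]setTI.
have mf : measurable_fun setT (fun p : measurableTypeR R * measurableTypeR R =>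
      p.2 * cos s - p.1 * sin s : measurableTypeR R).
  by apply: measurable_funB; apply: measurable_funM => //.
exact: mf.
Qed.

Lemma right_sector_nonincreasing (R : realType) (s t : R) :
  - (pi / 2) <= s -> s <= t -> t <= pi / 2 -> right_sector t `<=` right_sector s.
Proof.
move=> slo; rewrite le_eqVlt => /predU1P[->//|st] thi [x y] [/= x0 xy]; split => //=.
have coss : 0 <= cos s by apply: cos_ge0_pihalf; lra.
have cost : 0 <= cos t by apply: cos_ge0_pihalf; lra.
have [tpi|tpi] := eqVneq t (pi / 2).
  by move: xy; rewrite tpi sin_pihalf cos_pihalf mulr1 mulr0 leNgt x0.
have cost0 : 0 < cos t.
  apply: cos_gt0_pihalf; apply/andP; split; first lra.
  by rewrite lt_neqAle tpi.
have : 0 <= sin (t - s) by apply: sin_ge0_pi; apply/andP; split; lra.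
rewrite sinB subr_ge0 [cos t * _]mulrC => sints.
rewrite -(ler_pM2r cost0); apply: (@le_trans _ _ (x * sin t * cos s)).
  by rewrite -!mulrA ler_pM2l.
by rewrite (mulrAC y); apply: ler_wpM2r.
Qed.

Lemma right_sector_start (R : realType) :
  right_sector (- (pi / 2)) = [set p : R * R | 0 < p.1].
Proof.
apply/seteqP; split => [p []//|p /= p0]; split => //.
by rewrite sinN cosN sin_pihalf cos_pihalf mulr0 mulrN1 oppr_le0 ltW.
Qed.

(** In the frame turned by [al], the origin projects to 0 on the line of the segment, which is at
    signed distance [h], and [d] is the coordinate of the far end. With [w] running over the last
    quarter of the segment and [r] scaling towards the origin, these points form an open
    triangle. *)
Definition contains_thin_triangle (R : realType) (G : set (R * R)) (al d h : R) :=
  forall r w, 0 < r -> r < 1 -> 0 < w -> w < 1 ->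
    G (r * ((d - w / 4) * cos al - h * sin al),
       r * ((d - w / 4) * sin al + h * cos al)).

Lemma thin_triangle_area (R : realType) (G : set (R * R)) (al d h : R) :
  measurable G -> contains_thin_triangle G al d h ->
  ((`|h| / 8)%:E <= area G)%E.
Proof.
move=> mG GT; set c := cos al; set s := sin al.
have cs : c ^+ 2 + s ^+ 2 = 1 by exact: cos2Dsin2.
have -> : `|h| / 8 = `|det3 (0, 0) (d * c - h * s, d * s + h * c)
    ((d - 1 / 4) * c - h * s, (d - 1 / 4) * s + h * c)| / 2.
  rewrite /det3 /= [X in _ = `|X| / 2](_ : _ = h / 4 * (c ^+ 2 + s ^+ 2)); last by field.
  by rewrite cs mulr1 normrM (@ger0_norm _ (4^-1)) ?invr_ge0//; field.
apply: triangle_area => // t u v t0 u0 v0 tuv.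
have uv0 : 0 < u + v by lra.
(* With weights [u], [v] at the two vertices other than the origin, the scaling is [u + v] and the
   position along the short side is [v / (u + v)]. *)
have := GT (u + v) (v / (u + v)) uv0 ltac:(lra).
rewrite divr_gt0// ltr_pdivrMr//= => /(_ erefl ltac:(lra)).
by congr (G (_, _)); rewrite -/c -/s /=; field; lra.
Qed.

(** Since [d >= 1/2], every point of the last quarter keeps a coordinate [d'] above [d / 2], so its
    angle from the direction [al] stays below [2 * atan (h / d)]: doubling the angle at least
    doubles its tangent as long as the doubled angle is acute. Cross products avoid the case
    distinction. *)
Lemma thin_triangle_right_sector (R : realType) (G : set (R * R)) (al d h : R) :
  - (pi / 2) < al -> 1 / 2 <= d -> 0 < h -> al + 2 * atan (h / d) <= pi / 2 ->
  contains_thin_triangle G al d h ->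
  contains_thin_triangle (G `&` (right_sector al `\` right_sector (al + 2 * atan (h / d))))
    al d h.
Proof.
move=> allo d12 h0 alhi GT r w r0 r1 w0 w1; split; first exact: GT.
have d0 : 0 < d by lra.
set th := atan (h / d) in alhi *.
have hd0 : 0 < h / d by rewrite divr_gt0.
have thpi : th < pi / 2 by exact: atan_ltpi2.
have th0 : 0 < th by rewrite -(@atan0 R); exact: lt_atan.
have pi0 := pi_gt0 R.
have k0 : 0 < cos th by apply: cos_gt0_pihalf; apply/andP; split; lra.
have m0 : 0 < sin th by apply: sin_gt0_pihalf; apply/andP; split; lra.
have c0 : 0 < cos al by apply: cos_gt0_pihalf; apply/andP; split; lra.
have dm : d * sin th = h * cos th.
  have : tan th = h / d by exact: atanK.
  rewrite /tan => /(congr1 (fun z => z * cos th * d)).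
  by rewrite divfK ?gt_eqF// mulrC => ->; field; lra.
have c'0 : 0 <= cos (al + 2 * th) by apply: cos_ge0_pihalf; apply/andP; split; lra.
have s2 : sin (2 * th) = 2 * (sin th * cos th).
  by rewrite mulr_natl sin_mulr2n -mulr_natl [cos th * _]mulrC.
have c2 : cos (2 * th) = 2 * cos th ^+ 2 - 1.
  by rewrite mulr_natl cos_mulr2n -mulr_natl.
have km := cos2Dsin2 th; have cs := cos2Dsin2 al.
set d' := d - w / 4.
(* By the double-angle formulas and [d * sin th = h * cos th], this quantity equals [2 * (d' - d /
   2) * sin th * cos th + h * sin th ^+ 2]. *)
have far : 0 < d' * sin (2 * th) - h * cos (2 * th).
  have mk0 : 0 < sin th * cos th by rewrite mulr_gt0.
  have dmk : d * (sin th * cos th) = h * cos th ^+ 2 by rewrite mulrA dm; ring.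
  have : 0 < (d' - d / 2) * (sin th * cos th).
    by rewrite mulr_gt0// /d'; lra.
  have : 0 <= h * sin th ^+ 2 by rewrite mulr_ge0 ?sqr_ge0// ltW.
  have hkm : h * cos th ^+ 2 + h * sin th ^+ 2 = h by rewrite -mulrDr km mulr1.
  rewrite s2 c2 => ? ?; rewrite mulrBr mulr1; lra.
set al' := al + 2 * th in alhi c'0 *.
have sB : sin (2 * th) = sin al' * cos al - cos al' * sin al.
  by rewrite -sinB; congr sin; rewrite /al'; ring.
have cB : cos (2 * th) = cos al' * cos al + sin al' * sin al.
  by rewrite -cosB; congr cos; rewrite /al'; ring.
set x := r * (d' * cos al - h * sin al); set y := r * (d' * sin al + h * cos al).
have A1 : y * cos al - x * sin al = r * h.
  transitivity (r * h * (cos al ^+ 2 + sin al ^+ 2)); last by rewrite cs mulr1.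
  by rewrite /x /y; ring.
have A2 : x * sin al' - y * cos al' = r * (d' * sin (2 * th) - h * cos (2 * th)).
  by rewrite sB cB /x /y; ring.
have A1p : 0 < y * cos al - x * sin al by rewrite A1 mulr_gt0.
have A2p : 0 < x * sin al' - y * cos al' by rewrite A2 mulr_gt0.
(* A point strictly between the directions [al] and [al'] is a positive combination of them, and
   neither direction points to the left. *)
have x0 : 0 < x.
  have : x * sin (2 * th) = (y * cos al - x * sin al) * cos al' +
      (x * sin al' - y * cos al') * cos al by rewrite sB; ring.
  move=> xS; have : 0 < x * sin (2 * th).
    by rewrite xS ltr_wpDl ?mulr_ge0 ?mulr_gt0// ltW.
  by rewrite pmulr_lgt0// s2 !mulr_gt0.
split; first by split => //=; lra.
by move=> [_ /=]; lra.
Qed.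

Lemma area_sector_finite (R : realType) (G : set (R * R)) (s : R) :
  measurable G -> (area G < +oo)%E -> area (G `&` right_sector s) \is a fin_num.
Proof.
move=> mG Goo; rewrite ge0_fin_numE//; apply: le_lt_trans Goo.
by apply: le_area => //; apply: measurableI => //; exact: measurable_right_sector.
Qed.

Lemma area_sectorB (R : realType) (G : set (R * R)) (s t : R) :
  measurable G -> (area G < +oo)%E -> - (pi / 2) <= s -> s <= t -> t <= pi / 2 ->
  area (G `&` (right_sector s `\` right_sector t)) =
  (fine (area (G `&` right_sector s)) - fine (area (G `&` right_sector t)))%:E.
Proof.
move=> mG Goo slo st thi.
have mGS u : measurable (G `&` right_sector u).
  by apply: measurableI => //; exact: measurable_right_sector.
rewrite EFinB !fineK ?area_sector_finite//.
rewrite (_ : _ `&` (_ `\` _) = (G `&` right_sector s) `\` (G `&` right_sector t)).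
  rewrite area_setD//; last by rewrite -ge0_fin_numE// area_sector_finite.
  by apply: setIS; exact: right_sector_nonincreasing.
apply/seteqP; split => [p [Gp [? nS]]|p [[Gp ?] nS]]; split => //; first by move=> [].
by split => // ?; apply: nS.
Qed.

(** Only [h > 0], where the triangle lies counterclockwise from [al]; the other sign is obtained by
    reflection in the horizontal axis. *)
Definition thin_triangle_directions (R : realType) (G : set (R * R)) : set R :=
  [set al | - (pi / 2) < al /\ exists d h,
     [/\ 1 / 2 <= d, 0 < h, al + 2 * atan (h / d) <= pi / 2 &
        contains_thin_triangle G al d h]].

(** [greedy_cover] is applied to the area [v s] of [G] beyond the angle [s], with
    [l = 2 * atan (h / d)] and density [c = 1 / 32]. *)
Lemma outer_measure_thin_triangle_directions (R : realType) (G : set (R * R)) :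
  measurable G -> (area G < +oo)%E ->
  (mu_ext lambda (thin_triangle_directions G) <=
   (32 * fine (area (G `&` [set p | 0%R < p.1])))%:E)%E.
Proof.
move=> mG Goo; have pi0 := pi_gt0 R.
have mS := @measurable_right_sector R.
have mGS s : measurable (G `&` right_sector s) by exact: measurableI.
have fGS s := area_sector_finite s mG Goo.
pose v s := fine (area (G `&` right_sector s)).
have -> : 32 * fine (area (G `&` [set p | 0%R < p.1])) = v (- (pi / 2)) / (1 / 32).
  by rewrite /v right_sector_start; field.
apply: (@greedy_cover _ v (- (pi / 2)) (pi / 2)) => //.
- move=> s t slo st thi; apply: fine_le; rewrite ?fGS//.
  apply: le_area => //; apply: setIS; exact: right_sector_nonincreasing.
- by apply: fine_ge0.
- by lra.
- move=> al [allo [d [h [d12 h0 alhi _]]]] /=; rewrite in_itv/= ltW//=.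
  have : 0 < atan (h / d) by rewrite -(@atan0 R); apply: lt_atan; rewrite divr_gt0//; lra.
  lra.
move=> al [allo [d [h [d12 h0 alhi GT]]]].
have d0 : 0 < d by lra.
have hd0 : 0 < h / d by rewrite divr_gt0.
have th0 : 0 < atan (h / d) by rewrite -(@atan0 R); exact: lt_atan.
exists (2 * atan (h / d)); split => //; first by rewrite mulr_gt0.
set al' := al + 2 * atan (h / d) in alhi *.
have mD : measurable (G `&` (right_sector al `\` right_sector al')).
  by apply: measurableI => //; exact: measurableD.
have := thin_triangle_area mD (thin_triangle_right_sector allo d12 h0 alhi GT).
rewrite area_sectorB// ?(ltW allo)//; last by rewrite /al'; lra.
rewrite lee_fin gtr0_norm// => /(le_trans _); apply.
have := atan_le_id (ltW hd0).
(* As [d >= 1/2], the length [l] is at most [4 * h], and the triangle has area [h / 8], which gives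
   the density 1/32. *)
have : h / d <= 2 * h by rewrite ler_pdivrMr// -[leLHS]mulr1 [2 * h]mulrC -mulrA ler_pM2l//; lra.
lra.
Qed.

(** * Directions of radial segments *)

Lemma tan_piquarter_bounds (R : realType) (al : R) :
  - (pi / 4) <= al -> al <= pi / 4 -> -1 <= tan al /\ tan al <= 1.
Proof.
move=> lo hi; have pi0 := pi_gt0 R.
have inpi (x : R) : - (pi / 4) <= x -> x <= pi / 4 -> x \in `]-(pi / 2), (pi / 2)[.
  by move=> ? ?; rewrite in_itv/=; apply/andP; split; lra.
rewrite -(@tan_piquarter R) -tanN !leNgt !ltr_tan ?inpi -?leNgt//; lra.
Qed.

(** The map from [y] to [atan (y / x0)] is Lipschitz with constant [1 / x0]. The estimate is again
    an instance of [greedy_cover]: [H] is enlarged to an open set [U], and [v s] is the length of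
    [U] above [x0 * tan s]. *)
Lemma tan_preimage_outer_measure (R : realType) (x0 : R) (H M : set R) :
  0 < x0 -> measurable H -> (lambda H < +oo)%E ->
  (forall al, M al -> [/\ - (pi / 4) <= al, al <= pi / 4 & H (x0 * tan al)]) ->
  (mu_ext lambda M <= (fine (lambda H) / x0)%:E)%E.
Proof.
move=> x00 mH Hoo HM; apply/lee_addgt0Pr => e e0; have pi0 := pi_gt0 R.
have ex0 : 0 < e * x0 by rewrite mulr_gt0.
have [U [oU HU UHe]] := lebesgue_regularity_outer mH Hoo ex0.
have mU : measurable (U : set (measurableTypeR R)) by exact: open_measurable.
have lU : (lambda U <= (fine (lambda H) + e * x0)%:E)%E.
  rewrite -[X in lambda X](setDUK HU) EFinD fineK; last by rewrite ge0_fin_numE.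
  apply: (le_trans (measureU2 _ _ _)) => //; first exact: measurableD.
  by rewrite leeD2l// ltW.
have Uoo : (lambda U < +oo)%E by apply: le_lt_trans lU _; rewrite ltry.
have mUI s : measurable (U `&` `]s, +oo[ : set (measurableTypeR R)).
  exact: measurableI.
have fU s : lambda (U `&` `]s, +oo[) \is a fin_num.
  rewrite ge0_fin_numE//; apply: le_lt_trans Uoo.
  by apply: le_measure; rewrite ?inE//; exact: subIsetl.
pose v s := fine (lambda (U `&` `](x0 * tan s), +oo[)).
have hi0 : 0 <= atan (2 : R) by rewrite -(@atan0 R); apply: le_atan.
have inpi (x : R) : - (pi / 4) <= x -> x <= atan 2 -> x \in `]-(pi / 2), (pi / 2)[.
  by move=> ? ?; rewrite in_itv/=; have := atan_ltpi2 (2 : R) => ?; apply/andP; split; lra.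
have vlo : (v (- (pi / 4)) / x0) <= fine (lambda H) / x0 + e.
  rewrite ler_pdivrMr// (_ : _ * x0 = fine (lambda H) + e * x0); last by field; lra.
  rewrite -lee_fin fineK//; apply: le_trans lU.
  by apply: le_measure; rewrite ?inE//; exact: subIsetl.
apply: (@le_trans _ _ (v (- (pi / 4)) / x0)%:E); last by rewrite -EFinD lee_fin.
(* The right end is [atan 2] rather than [pi / 4], to leave room for an interval that starts at the
   direction [pi / 4]. *)
apply: (@greedy_cover _ v (- (pi / 4)) (atan 2)) => //.
- move=> s t slo st thi; apply: fine_le; rewrite ?fU//.
  apply: le_measure; rewrite ?inE//; apply: setIS => y /=; rewrite !in_itv/= !andbT.
  apply: le_lt_trans; rewrite ler_pM2l// leNgt ltr_tan -?leNgt// inpi//; lra.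
- by apply: fine_ge0.
- by lra.
- move=> al /HM[lo hi _] /=; rewrite in_itv/= lo (le_trans hi)//.
  by rewrite -(@atan1 R); apply: le_atan; lra.
move=> al /HM[lo hi Hal].
have [tlo thi] := tan_piquarter_bounds lo hi.
have Ual : U (x0 * tan al) by exact: HU.
have /nbhs_ballP[d /= d0 dU] : nbhs (x0 * tan al) U by exact: open_nbhs_nbhs.
set y := x0 * tan al in Hal Ual dU *.
have yx : y <= x0 by rewrite /y -[leRHS]mulr1 ler_pM2l.
(* [d / 2] keeps the interval from [y] to [y + k] inside [U], and [x0] keeps [(y + k) / x0] at most
   2. *)
pose k := Num.min (d / 2) x0.
have k0 : 0 < k by rewrite lt_min divr_gt0.
have kd : k < d by rewrite (@le_lt_trans _ _ (d / 2))// ?ge_min ?lexx//; lra.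
have kx : k <= x0 by rewrite ge_min lexx orbT.
have alE : al = atan (y / x0).
  by rewrite /y [x0 * _]mulrC mulfK ?gt_eqF// tanK// in_itv/=; apply/andP; split; lra.
have yk : y / x0 < (y + k) / x0 by rewrite ltr_pM2r ?invr_gt0//; lra.
exists (atan ((y + k) / x0) - al); split.
- by rewrite subr_gt0 [ltLHS]alE; exact: lt_atan.
- by rewrite addrC subrK; apply: le_atan; rewrite ler_pdivrMr//; lra.
rewrite [al + _]addrC subrK.
have -> : v al - v (atan ((y + k) / x0)) = k.
  have -> : v (atan ((y + k) / x0)) = fine (lambda (U `&` `](y + k), +oo[)).
    by rewrite /v atanK [x0 * _]mulrC divfK ?gt_eqF.
  rewrite /v.
  have -> : U `&` `](x0 * tan al), +oo[ = `]y, (y + k)] `|` (U `&` `](y + k), +oo[).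
    apply/seteqP; split => z /=; rewrite !in_itv/= !andbT.
      by move=> [Uz yz]; have [zk|kz] := leP z (y + k); [left; rewrite yz|right].
    move=> [/andP[yz zk]|[Uz kz]]; split => //; last by rewrite -/y; lra.
    by apply: dU; rewrite /ball/= ltr_distlC; apply/andP; split; lra.
  rewrite measureU//; last first.
    by rewrite -subset0 => z [] /=; rewrite !in_itv/= !andbT => /andP[_ ?] [_ ?]; lra.
  rewrite [X in fine (X + _)](_ : _ = k%:E); last first.
    by rewrite [LHS]lebesgue_measure_itv/= lte_fin ltrDl k0 -EFinD; congr EFin; ring.
  by rewrite fineD//= addrK.
rewrite [X in _ - X]alE mulrC -ler_pdivlMr//.
apply: (le_trans (atan_lipschitz (ltW yk))).
by rewrite -mulrBl addrC addKr.
Qed.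

Definition contains_ray (R : realType) (G : set (R * R)) (al : R) :=
  forall r, 0 < r -> r < 1 / 2 -> G (r * cos al, r * sin al).

(** A rational bound just below the square root of 1/2. Half of it, 7/20, is the width of a strip
    that a segment of length 1/2 crosses from the origin. *)
Lemma cos_piquarter_ge (R : realType) (al : R) :
  - (pi / 4) <= al -> al <= pi / 4 -> 7 / 10 <= cos al.
Proof.
move=> lo hi; have pi0 := pi_gt0 R; have [t1 t2] := tan_piquarter_bounds lo hi.
have c0 : 0 < cos al by apply: cos_gt0_pihalf; apply/andP; split; lra.
have st : sin al = tan al * cos al by rewrite /tan divfK ?gt_eqF.
have cs := cos2Dsin2 al; rewrite st in cs.
have tt : tan al ^+ 2 <= 1 by nra.
have : (tan al * cos al) ^+ 2 <= cos al ^+ 2.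
  by rewrite exprMn ler_piMl ?sqr_ge0.
by rewrite leNgt => ?; apply/negP => ?; nra.
Qed.

(** Each such segment meets the vertical line at abscissa [x0 < 7 / 20] at height [x0 * tan al], so
    one short slice of [G] bounds the set of directions. *)
Lemma outer_measure_ray_directions (R : realType) (G : set (R * R)) (M : set R) :
  measurable G -> (area G < +oo)%E ->
  (forall al, M al -> [/\ - (pi / 4) <= al, al <= pi / 4 & contains_ray G al]) ->
  (mu_ext lambda M <= (17 * fine (area G))%:E)%E.
Proof.
move=> mG Goo HM; apply/lee_addgt0Pr => e e0.
have aE : area G = (fine (area G))%:E by rewrite fineK// ge0_fin_numE.
set a := fine (area G) in aE *.
have a0 : 0 <= a by apply: fine_ge0.
have K0 : 0 < 17 * a + e by lra.
(* If every slice were longer than [(17 * a + e) * x0], integrating up to 7/20 would give area at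
   least [(17 * a + e) * 49 / 800]. This exceeds [a], because [17 * 49 = 833 > 800]; the term [e]
   covers [a = 0]. *)
have [x0 [x00 x01 x0S]] : exists x0, [/\ 0 < x0, x0 < 7 / 20 &
    (lambda (xsection G x0) <= ((17 * a + e) * x0)%:E)%E].
  apply: contrapT => none.
  have : (((17 * a + e) * ((7 / 20) ^+ 2 - 0 ^+ 2) / 2 + 0 * (7 / 20 - 0))%:E <=
      \int[lambda]_(x in `]0%R, (7 / 20)%R[) lambda (xsection G x))%E.
    apply: integral_xsection_ge => //.
      by move=> x /andP[x0 _]; rewrite addr0 mulr_ge0// ltW.
    move=> x /andP[x0 x1]; rewrite addr0 leNgt; apply/negP => /ltW xS.
    by apply: none; exists x.
  have := integral_itv2_le_area 0 (7 / 20) (7 / 20) mG.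
  rewrite set_itvoo0 integral_set0 adde0 aE => /[swap] /le_trans /[apply].
  by rewrite lee_fin; lra.
have mH : measurable (xsection G x0) by exact: measurable_xsection.
have Hoo : (lambda (xsection G x0) < +oo)%E by apply: le_lt_trans x0S _; rewrite ltry.
apply: (le_trans (tan_preimage_outer_measure x00 mH Hoo _ (M := M))).
  move=> al /HM[lo hi ray]; split => //.
  have c7 := cos_piquarter_ge lo hi.
  have c0 : 0 < cos al by lra.
  rewrite /xsection /= inE.
  have := ray (x0 / cos al); rewrite divfK ?gt_eqF// mulrAC -mulrA; apply.
    by rewrite divr_gt0.
  by rewrite ltr_pdivrMr//; lra.
rewrite -EFinD lee_fin ler_pdivrMr// -lee_fin fineK//.
by rewrite ge0_fin_numE.
Qed.

Lemma area_preimage (R : realType) (f : R * R -> R * R) (A : set (R * R)) :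
  measure_preserving area f -> measurable A ->
  measurable (f @^-1` A) /\ area (f @^-1` A) = area A.
Proof.
by move=> pf mA; split; [exact: measurable_preimage pf mA|exact: pf.2].
Qed.

Lemma lebesgue_preserving_opp (R : realType) :
  measure_preserving (@lebesgue_measure R) (-%R).
Proof.
rewrite (_ : -%R = fun x : R => 0 - x); last by apply/funext => x; rewrite sub0r.
exact: lebesgue_preserving_subr.
Qed.

Lemma area_preserving_conj (R : realType) :
  measure_preserving area (fun p : R * R => (p.1, - p.2)).
Proof.
exact: area_preserving_pair (@lebesgue_preserving_id R) (@lebesgue_preserving_opp R).
Qed.

Lemma area_preserving_opp (R : realType) :
  measure_preserving area (fun p : R * R => (- p.1, - p.2)).
Proof.
exact: area_preserving_pair (@lebesgue_preserving_opp R) (@lebesgue_preserving_opp R).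
Qed.

Lemma contains_ray_sector (R : realType) (G : set (R * R)) (al s t : R) :
  - (pi / 2) < al -> al < pi / 2 -> - (pi / 2) <= s -> t <= pi / 2 ->
  s <= al -> al < t -> contains_ray G al ->
  contains_ray (G `&` (right_sector s `\` right_sector t)) al.
Proof.
move=> allo alhi slo thi sal alt ray r r0 r12; have pi0 := pi_gt0 R.
have c0 : 0 < cos al by apply: cos_gt0_pihalf; apply/andP; split; lra.
have Es : 0 <= sin (al - s) by apply: sin_ge0_pi; apply/andP; split; lra.
have Et : 0 < sin (t - al) by apply: sin_gt0_pi; apply/andP; split; lra.
split; first exact: ray.
split.
  split => /=; first by rewrite mulr_gt0.
  by rewrite -!mulrA ler_pM2l// -subr_ge0 -sinB.
move=> [_ /=]; rewrite -!mulrA ler_pM2l// -subr_ge0.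
rewrite [cos al * _]mulrC [sin al * _]mulrC -opprB oppr_ge0 leNgt.
by rewrite -sinB Et.
Qed.

Definition ray_directions (R : realType) (G : set (R * R)) (s t : R) : set R :=
  [set al | [/\ - (pi / 2) < al, s <= al, al < t & contains_ray G al]].

(** The half-plane is cut at the angles [-pi/4] and [pi/4]. Exchanging coordinates brings the upper
    sector into the range of the slicing bound, and a quarter turn brings the lower one there. The
    areas of the three disjoint sectors telescope. *)
Lemma outer_measure_ray_half_plane (R : realType) (G : set (R * R)) :
  measurable G -> (area G < +oo)%E ->
  (mu_ext lambda (ray_directions G (- (pi / 2)) (pi / 2)) <=
   (17 * fine (area (G `&` [set p | 0%R < p.1])))%:E)%E.
Proof.
move=> mG Goo; have pi0 := pi_gt0 R; rewrite -right_sector_start.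
pose v s := fine (area (G `&` right_sector s)).
rewrite -[fine _]/(v (- (pi / 2))).
pose S s t := G `&` (right_sector s `\` right_sector t).
have mS s t : measurable (S s t).
  by apply: measurableI => //; apply: measurableD; exact: measurable_right_sector.
have rayS s t al : - (pi / 2) <= s -> t <= pi / 2 -> ray_directions G s t al ->
    contains_ray (S s t) al.
  move=> slo thi [allo sal alt ray]; apply: contains_ray_sector => //.
  exact: lt_le_trans thi.
have SE s t : - (pi / 2) <= s -> s <= t -> t <= pi / 2 ->
    area (S s t) = (v s - v t)%:E by exact: area_sectorB.
have swap := @area_preserving_swap R.
have conj := @area_preserving_conj R.
have mid : (mu_ext lambda (ray_directions G (- (pi / 4)) (pi / 4)) <=
    (17 * (v (- (pi / 4)) - v (pi / 4)))%:E)%E.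
  have vE := @SE (- (pi / 4)) (pi / 4) ltac:(lra) ltac:(lra) ltac:(lra).
  have -> : v (- (pi / 4)) - v (pi / 4) = fine (area (S (- (pi / 4)) (pi / 4))) by rewrite vE.
  apply: outer_measure_ray_directions => //; first by rewrite vE ltry.
  move=> al alS; have [allo ? ? _] := alS; split => //; first exact: ltW.
  by apply: rayS => //; lra.
have top : (mu_ext lambda (ray_directions G (pi / 4) (pi / 2)) <=
    (17 * (v (pi / 4) - v (pi / 2)))%:E)%E.
  have vE := @SE (pi / 4) (pi / 2) ltac:(lra) ltac:(lra) ltac:(lra).
  have [mT aT] := area_preimage swap (mS (pi / 4) (pi / 2)).
  have -> : v (pi / 4) - v (pi / 2) =
      fine (area ((fun p => (p.2, p.1)) @^-1` S (pi / 4) (pi / 2))) by rewrite aT vE.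
  apply: (mu_ext_preimage_le (@lebesgue_preserving_subr R (pi / 2))
    (N := (fun x => pi / 2 - x) @^-1` ray_directions G (pi / 4) (pi / 2))).
    by move=> al; rewrite /preimage /= opprB addrC subrK.
  apply: (outer_measure_ray_directions mT); first by rewrite aT vE ltry.
  move=> al /= alS; have [allo ? ? _] := alS; split; [lra|lra|].
  move=> r r0 r12; have /= := @rayS (pi / 4) (pi / 2) _ ltac:(lra) ltac:(lra) alS r r0 r12.
  by rewrite cosB sinB sin_pihalf cos_pihalf !mul0r !mul1r add0r subr0.
have bot : (mu_ext lambda (ray_directions G (- (pi / 2)) (- (pi / 4))) <=
    (17 * (v (- (pi / 2)) - v (- (pi / 4))))%:E)%E.
  have vE := @SE (- (pi / 2)) (- (pi / 4)) ltac:(lra) ltac:(lra) ltac:(lra).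
  have [mC aC] := area_preimage conj (mS (- (pi / 2)) (- (pi / 4))).
  have [mT aT] := area_preimage swap mC; rewrite aC in aT.
  have -> : v (- (pi / 2)) - v (- (pi / 4)) = fine (area ((fun p => (p.2, p.1)) @^-1`
      ((fun p => (p.1, - p.2)) @^-1` S (- (pi / 2)) (- (pi / 4))))) by rewrite aT vE.
  apply: (mu_ext_preimage_le (@lebesgue_preserving_addr R (pi / 2))
    (N := (fun x => x - pi / 2) @^-1` ray_directions G (- (pi / 2)) (- (pi / 4)))).
    by move=> al; rewrite /preimage /= addrK.
  apply: (outer_measure_ray_directions mT); first by rewrite aT vE ltry.
  move=> al /= alS; have [allo ? ? _] := alS; split; [lra|lra|].
  move=> r r0 r12.
  have /= := @rayS (- (pi / 2)) (- (pi / 4)) _ ltac:(lra) ltac:(lra) alS r r0 r12.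
  by rewrite cosBpihalf sinBpihalf mulrN.
have vhi : 0 <= v (pi / 2) by apply: fine_ge0.
have sub : ray_directions G (- (pi / 2)) (pi / 2) `<=`
    ray_directions G (- (pi / 2)) (- (pi / 4)) `|`
    (ray_directions G (- (pi / 4)) (pi / 4) `|` ray_directions G (pi / 4) (pi / 2)).
  move=> al [allo _ alhi ray].
  have [l1|l1] := ltP al (- (pi / 4)); first by left; split => //; exact: ltW.
  by have [l2|l2] := ltP al (pi / 4); right; [left|right].
apply: (le_trans (le_mu_ext _ sub)).
apply: (le_trans (outer_measureU2 (mu_ext lambda) _ _)).
apply: (le_trans (leeD2l _ (outer_measureU2 (mu_ext lambda) _ _))).
apply: (le_trans (leeD bot (leeD mid top))).
by rewrite -!EFinD lee_fin; lra.
Qed.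

(** * All directions reached in one half-plane *)

Definition right_directions (R : realType) (G : set (R * R)) : set R :=
  [set al | [/\ - (pi / 2) < al, al < pi / 2 & contains_ray G al \/
    exists d h, [/\ 1 / 2 <= d, h != 0, `|al| + 2 * atan (`|h| / d) <= pi / 2 &
      contains_thin_triangle G al d h]]].

(** [81 = 17 + 32 + 32]: radial segments, triangles with [h > 0], and triangles with [h < 0], which
    reflection turns into [h > 0] at direction [- al]. *)
Lemma outer_measure_right_directions (R : realType) (G : set (R * R)) :
  measurable G -> (area G < +oo)%E ->
  (mu_ext lambda (right_directions G) <=
   (81 * fine (area (G `&` [set p | 0%R < p.1])))%:E)%E.
Proof.
move=> mG Goo; pose conj (p : R * R) := (p.1, - p.2).
have pconj : measure_preserving area conj := @area_preserving_conj R.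
have [mG' aG'] := area_preimage pconj mG.
have up := outer_measure_thin_triangle_directions mG Goo.
have down : (mu_ext lambda (-%R @^-1` thin_triangle_directions (conj @^-1` G)) <=
    (32 * fine (area (G `&` [set p | 0%R < p.1])))%:E)%E.
  apply: (mu_ext_preimage_le (@lebesgue_preserving_opp R) (@subset_refl _ _)).
  have mH : measurable (G `&` [set p : R * R | 0%R < p.1]).
    by rewrite -right_sector_start; apply: measurableI => //; exact: measurable_right_sector.
  have [_ <-] := area_preimage pconj mH.
  by apply: outer_measure_thin_triangle_directions => //; rewrite aG'.
have ray := outer_measure_ray_half_plane mG Goo.
set a := fine _ in up down ray *.
have sub : right_directions G `<=` ray_directions G (- (pi / 2)) (pi / 2) `|`
    (thin_triangle_directions G `|` -%R @^-1` thin_triangle_directions (conj @^-1` G)).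
  move=> al [allo alhi [r|[d [h [d12 h0 alth GT]]]]].
    by left; split => //; exact: ltW.
  move: h0; rewrite neq_lt => /orP[h0|h0]; right; [right|left].
    split; first by rewrite ltrN2.
    exists d, (- h); rewrite (ltr0_norm h0) in alth; split => //; first by rewrite oppr_gt0.
      by have := ler_norm (- al); rewrite normrN; lra.
    move=> r w r0 r1 w0 w1; rewrite /conj/= cosN sinN.
    have := GT r w r0 r1 w0 w1; congr (G (_, _)); ring.
  split => //; exists d, h; rewrite (gtr0_norm h0) in alth; split => //.
  by have := ler_norm al; lra.
apply: (le_trans (le_mu_ext _ sub)).
apply: (le_trans (outer_measureU2 (mu_ext lambda) _ _)).
apply: (le_trans (leeD2l _ (outer_measureU2 (mu_ext lambda) _ _))).
apply: (le_trans (leeD ray (leeD up down))).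
by rewrite -!EFinD lee_fin; lra.
Qed.

(** * Star-shaped sets centred at the origin *)

Section kakeya_at_origin.
Context {R : realType}.
Variables (F G : set (R * R)).
Hypotheses (starF : forall p r, F p -> 0 <= r -> r <= 1 -> F (r * p.1, r * p.2))
  (segF : forall al, - (pi / 2) < al -> al < pi / 2 -> exists p, forall t,
     0 <= t -> t <= 1 -> F (p.1 + t * cos al, p.2 + t * sin al))
  (mG : measurable G) (FG : F `<=` G).

(* [s] and [h] are the coordinates of [p] along and across the direction. *)
Let seg_coordinates (al : R) : - (pi / 2) < al -> al < pi / 2 ->
  exists s h, forall r t, 0 <= r -> r <= 1 -> 0 <= t -> t <= 1 ->
    F (r * ((s + t) * cos al - h * sin al), r * ((s + t) * sin al + h * cos al)).
Proof.
move=> allo alhi; have [[x y] Hp] := segF allo alhi.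
exists (x * cos al + y * sin al), (- x * sin al + y * cos al) => r t r0 r1 t0 t1.
have cs := cos2Dsin2 al.
have := starF (Hp t t0 t1) r0 r1; congr (F (_, _)); congr (r * _) => /=.
  rewrite -[x in x + _]mulr1 -cs; ring.
rewrite -[y in y + _]mulr1 -cs; ring.
Qed.

Hypothesis Goo : (area G < +oo)%E.
Let a := fine (area G).

Let aE : area G = a%:E.
Proof. by rewrite /a fineK// ge0_fin_numE. Qed.

Let neg (p : R * R) : R * R := (- p.1, - p.2).

(** Along its line the segment occupies the coordinates from [s] to [s + 1]. If [s >= -1/2], its
    last end has [d = s + 1]; otherwise its first end, seen after the central symmetry, has
    [d = - s] and height [- h]. Either way [d >= 1/2], and the third case collects the steep
    directions whose doubled angle would pass the vertical. *)
Let direction_cover (al : R) : - (pi / 2) < al -> al < pi / 2 ->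
  [\/ right_directions G al, right_directions (neg @^-1` G) al |
      pi / 2 - 8 * a < `|al|].
Proof.
move=> allo alhi; have [s [h Hs]] := seg_coordinates allo alhi.
(* The origin and the whole unit segment span a triangle of area [|h| / 2] in [G]. *)
have ha : `|h| <= 2 * a.
  have : ((`|det3 (0, 0) (s * cos al - h * sin al, s * sin al + h * cos al)
      ((s + 1) * cos al - h * sin al, (s + 1) * sin al + h * cos al)| / 2)%:E <= area G)%E.
    apply: triangle_area => // t u v t0 u0 v0 tuv; apply: FG => /=.
    have uv0 : 0 < u + v by lra.
    have := Hs (u + v) (v / (u + v)) ltac:(lra) ltac:(lra).
    rewrite divr_ge0 ?ler_pdivrMr//; try lra.
    move=> /(_ erefl ltac:(lra)); congr (F (_, _)); field; lra.
  rewrite aE lee_fin /det3 /=.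
  rewrite (_ : _ - _ = - h * (cos al ^+ 2 + sin al ^+ 2)); last by ring.
  by rewrite cos2Dsin2 mulr1 normrN; lra.
have small d : 1 / 2 <= d -> atan (`|h| / d) <= 4 * a.
  move=> d12; have d0 : 0 < d by lra.
  apply: le_trans (atan_le_id _) _; first by rewrite divr_ge0// ltW.
  rewrite ler_pdivrMr//; apply: le_trans ha _.
  have a0 : 0 <= a by apply: fine_ge0.
  have : 2 * a * 1 <= 2 * a * (2 * d) by apply: ler_wpM2l; lra.
  lra.
have [sge|slt] := leP (- (1 / 2)) s.
- have d12 : 1 / 2 <= s + 1 by lra.
  have d0 : 0 < s + 1 by lra.
  have [h0|h0] := eqVneq h 0.
    constructor 1; split => //; left => r r0 r12; apply: FG.
    have := Hs (r / (s + 1)) 1; rewrite h0 !mul0r subr0 addr0 !mulrA divfK ?gt_eqF//.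
    by apply; rewrite ?divr_ge0 ?ler_pdivrMr//; lra.
  have [good|bad] := leP (`|al| + 2 * atan (`|h| / (s + 1))) (pi / 2).
    constructor 1; split => //; right; exists (s + 1), h; split => //.
    move=> r w r0 r1 w0 w1; apply: FG.
    have := Hs r (1 - w / 4) ltac:(lra) ltac:(lra) ltac:(lra) ltac:(lra).
    by rewrite addrA.
  by constructor 3; have := small _ d12; lra.
- have d12 : 1 / 2 <= - s by lra.
  have d0 : 0 < - s by lra.
  have [h0|h0] := eqVneq h 0.
    constructor 2; split => //; left => r r0 r12; apply: FG.
    have := Hs (r / - s) 0; rewrite h0 !mul0r subr0 !addr0 => Hr.
    have rs0 : 0 <= r / - s by rewrite divr_ge0//; lra.
    have rs1 : r / - s <= 1 by rewrite ler_pdivrMr//; lra.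
    by have := Hr rs0 rs1 (lexx _) ler01; congr (F (_, _)) => /=; field; lra.
  have [good|bad] := leP (`|al| + 2 * atan (`|h| / - s)) (pi / 2).
    constructor 2; split => //; right; exists (- s), (- h); rewrite normrN oppr_eq0.
    split => //; move=> r w r0 r1 w0 w1; apply: FG.
    have := Hs r (w / 4) ltac:(lra) ltac:(lra) ltac:(lra) ltac:(lra).
    by congr (F (_, _)) => /=; ring.
  by constructor 3; have := small _ d12; lra.
Qed.

Lemma kakeya_area_finite : pi <= 97 * a.
Proof.
have pi0 := pi_gt0 R.
have a0 : 0 <= a by apply: fine_ge0.
have [mN aN] := area_preimage (@area_preserving_opp R) mG.
have right := outer_measure_right_directions mG Goo.
have left : (mu_ext lambda (right_directions (neg @^-1` G)) <=
    (81 * fine (area (neg @^-1` G `&` [set p | 0%R < p.1])))%:E)%E.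
  by apply: outer_measure_right_directions => //; rewrite aN.
set ar := fine _ in right; set al := fine _ in left.
have mH : measurable [set p : R * R | 0%R < p.1].
  by rewrite -right_sector_start; exact: measurable_right_sector.
(* The central symmetry carries the second set back to the left half of [G], which is disjoint from
   the right half. *)
have ara : ar + al <= a.
  have finI (A : set (R * R)) : measurable A -> (area A < +oo)%E ->
      area (A `&` [set p | 0 < p.1]) \is a fin_num.
    by rewrite -right_sector_start; exact: area_sector_finite.
  have fN := finI _ mN ltac:(by rewrite aN); have fG := finI _ mG Goo.
  have mGr := measurableI _ _ mG mH.
  have [mL aL] := area_preimage (@area_preserving_opp R) (measurableI _ _ mN mH).
  have alE : area (neg @^-1` (neg @^-1` G `&` [set p | 0%R < p.1])) = al%:E.
    by rewrite /al fineK//; exact: aL.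
  rewrite -lee_fin EFinD /ar fineK// -alE -area_setU// -?aE.
    by apply: le_area => //; [exact: measurableU|move=> [x y] [[]//|[]];
      by rewrite /neg /preimage /= !opprK].
  by rewrite -subset0 => -[x y] [[_ /= x0] [_ /=]]; rewrite oppr_gt0 ltNge (ltW x0).
(* The directions beyond [b] on either side fill two intervals of length [8 * a], so the total is at
   most [81 * a + 16 * a = 97 * a]. *)
pose b := pi / 2 - 8 * a.
pose I : set R := `](- (pi / 2)), (pi / 2)[%classic.
have sub : I `<=` right_directions G `|`
    (right_directions (neg @^-1` G) `|` (`[(- (pi / 2)), (- b)] `|` `[b, (pi / 2)])).
  move=> x; rewrite /I /= in_itv/= => /andP[xlo xhi].
  have [|?|bx] := direction_cover xlo xhi; [by left|by right; left|right; right].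
  have [x0|x0] := leP 0 x; [right|left]; rewrite /= ?in_itv/=; apply/andP.
    by move: bx; rewrite ger0_norm// /b; split; lra.
  by move: bx; rewrite ltr0_norm// /b; split; lra.
have itv (x y : R) : y - x <= 8 * a -> (mu_ext lambda `[x, y] <= (8 * a)%:E)%E.
  move=> xy; rewrite measurable_mu_extE//; rewrite /= lebesgue_measure_itv/= lte_fin.
  by case: ifPn => _; rewrite -?EFinD lee_fin; lra.
have : (mu_ext lambda I <=
    (81 * ar)%:E + ((81 * al)%:E + ((8 * a)%:E + (8 * a)%:E)))%E.
  apply: (le_trans (le_mu_ext _ sub)).
  apply: (le_trans (outer_measureU2 (mu_ext lambda) _ _)); apply: leeD => //.
  apply: (le_trans (outer_measureU2 (mu_ext lambda) _ _)); apply: leeD => //.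
  apply: (le_trans (outer_measureU2 (mu_ext lambda) _ _)).
  by apply: leeD; apply: itv; rewrite /b; lra.
rewrite /I measurable_mu_extE//; rewrite /= lebesgue_measure_itv/= lte_fin.
by rewrite ifT -?EFinD ?lee_fin; lra.
Qed.

End kakeya_at_origin.

(** * Arbitrary centres and the outer measure *)

Lemma star_shaped_kakeya_area (R : realType) (E G : set (R * R)) :
  star_shaped_kakeya E -> measurable G -> E `<=` G -> ((pi / 98)%:E <= area G)%E.
Proof.
move=> [[[u v] Eo star] dir] mG EG; have pi0 := pi_gt0 R.
have [->|Goo] := eqVneq (area G) +oo%E; first exact: leey.
pose tr (p : R * R) := (p.1 + u, p.2 + v).
have ptr : measure_preserving area tr.
  exact: area_preserving_pair (lebesgue_preserving_addr u) (lebesgue_preserving_addr v).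
have [mG0 aG0] := area_preimage ptr mG.
have G0oo : (area (tr @^-1` G) < +oo)%E by rewrite aG0 ltey.
have starF p r : (tr @^-1` E) p -> 0 <= r -> r <= 1 -> (tr @^-1` E) (r * p.1, r * p.2).
  move=> Ep r0 r1; apply: (star _ Ep); exists r; first by rewrite /= in_itv/= r0.
  by rewrite /tr /=; congr pair; ring.
have segE al p t : segment p (p.1 + cos al, p.2 + sin al) `<=` E -> 0 <= t -> t <= 1 ->
    E (p.1 + t * cos al, p.2 + t * sin al).
  move=> pE t0 t1; apply: pE; exists t; first by rewrite /= in_itv/= t0.
  by congr pair => /=; ring.
have segF al : - (pi / 2) < al -> al < pi / 2 -> exists p, forall t,
    0 <= t -> t <= 1 -> (tr @^-1` E) (p.1 + t * cos al, p.2 + t * sin al).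
  move=> allo alhi; have [al0|al0] := leP 0 al.
    have [p /segE pE] : has_unit_segment_at E al by apply: dir; apply/andP; split; lra.
    exists (p.1 - u, p.2 - v) => t t0 t1; have := pE t t0 t1.
    by congr (E (_, _)) => /=; ring.
  (* Directions are given in [[0, pi)]; for negative [al], the segment in direction [al + pi] is run
     backwards from its other end. *)
  have [p /segE pE] : has_unit_segment_at E (al + pi) by apply: dir; apply/andP; split; lra.
  exists (p.1 - cos al - u, p.2 - sin al - v) => t t0 t1.
  have := pE (1 - t) ltac:(lra) ltac:(lra); rewrite cosDpi sinDpi.
  by congr (E (_, _)) => /=; ring.
have EG0 : tr @^-1` E `<=` tr @^-1` G by move=> p; exact: EG.
have := kakeya_area_finite starF segF mG0 EG0 G0oo; rewrite aG0 => le97.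
have Gfin : area G \is a fin_num by rewrite ge0_fin_numE// ltey.
(* The area is in fact at least [pi / 97]. *)
by rewrite -(fineK Gfin) lee_fin; lra.
Qed.

Unset Implicit Arguments.

Theorem theorem1p1 (R : realType) (E : set (R * R)) :
  star_shaped_kakeya E -> ((pi / 98)%:E <= lebesgue_outer_measure2 E)%E.
Proof.
move=> HE; apply: le_ereal_inf_tmp => _ [A [mA EA] <-].
have mUA : measurable (\bigcup_n A n) by exact: bigcupT_measurable.
apply: le_trans (star_shaped_kakeya_area HE mUA EA) _.
by apply: measure_sigma_subadditive.
Qed.
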